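(* Let $\langle X,\tau,\tau_S\rangle$ be an S4-subordination space, and let $\langle \mathrm{Ul}(\mathrm{Clop}(X)),\tau_\varphi,\tau_{\varphi_S}\rangle$ be the dual space of the S4-subordination algebra $\langle\mathrm{Clop}(X),\prec_S\rangle$. Then the map $\varepsilon:X\to\mathrm{Ul}(\mathrm{Clop}(X))$, $\varepsilon(x)=\{U\in\mathrm{Clop}(X):x\in U\}$, is a bitopological homeomorphism, i.e. $\varepsilon$ is a homeomorphism from $\langle X,\tau\rangle$ to $\langle\mathrm{Ul}(\mathrm{Clop}(X)),\tau_\varphi\rangle$ and a homeomorphism from $\langle X,\tau_S\rangle$ to $\langle\mathrm{Ul}(\mathrm{Clop}(X)),\tau_{\varphi_S}\rangle$.
   Context: Let $\langle X,\tau,\tau_S\rangle$ be a bitopological space (a set with two topologies). $\mathrm{Clop}(X)$ denotes the Boolean algebra of clopen subsets of $\langle X,\tau\rangle$; $\mathrm{int}_S$ denotes interior with respect to $\tau_S$. For $U,V\in\mathrm{Clop}(X)$, $U\prec_S V$ means $U\subseteq\mathrm{int}_S(V)$. For $x,y\in X$: $x\leq_S y$ iff for all $U\in\mathrm{Clop}(X)$, $x\in\mathrm{int}_S(U)$ implies $y\in\mathrm{int}_S(U)$; $x\triangleleft_S y$ iff for all $U\in\mathrm{Clop}(X)$, $x\in\mathrm{int}_S(U)$ implies $y\in U$. The space is an S4-subordination space if: (Sp1) $\langle X,\tau\rangle$ is a Stone space; (Sp2) $\{\mathrm{int}_S(U):U\in\mathrm{Clop}(X)\}$ is a base for $\tau_S$;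 (Sp3) $\mathrm{int}_S(U)\in\tau$ for each $U\in\mathrm{Clop}(X)$; (Sp4) $\triangleleft_S\subseteq\leq_S$. A subordination on a Boolean algebra $A$ is a binary relation $\prec$ on $A$ such that: (S1) $0\prec 0$ and $1\prec 1$; (S2) $a\prec b$ and $a\prec c$ imply $a\prec b\wedge c$; (S3) $a\prec c$ and $b\prec c$ imply $a\vee b\prec c$; (S4) $a\leq b\prec c\leq d$ implies $a\prec d$. It is an S4-subordination algebra if moreover (S5) $a\prec b$ implies $a\leq b$, and (S6) $a\prec b$ implies that there is $c$ with $a\prec c\prec b$. If $\langle X,\tau,\tau_S\rangle$ is an S4-subordination space then $\langle\mathrm{Clop}(X),\prec_S\rangle$ is an S4-subordination algebra. The dual space of an S4-subordination algebra $\langle A,\prec\rangle$ is the bitopological space on the set $\mathrm{Ul}(A)$ of ultrafilters of $A$ whose first topology has base the sets $\varphi(a)=\{x:a\in x\}$ ($a\in A$) (Stone topology), and whose second topology has base the sets $\beta({\downarrow}a)=\{x: x\cap{\downarrow}a\neq\emptyset\}$ ($a\in A$), where ${\downarrow}a=\{b\in A:b\prec a\}$. (The set $\beta({\downarrow}a)$ is the interior of $\varphi(a)$ in the second topology.) *)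

(* Defs.v *)
From HB Require Import structures.
From mathcomp Require Import all_boot all_order.
From mathcomp Require Import mathcomp_extra boolp classical_sets filter.
From mathcomp Require Import topology.

Set Implicit Arguments.
Unset Strict Implicit.
Unset Printing Implicit Defensive.

Import Order.TTheory.

Local Open Scope classical_set_scope.

(* [Topological T] is the class (not the bundled type) of topologies on T, so
   that two different topologies can live on one carrier. *)
Record bitopologicalType := BiTop {
  bitop_sort :> Type;
  bitop_fst : Topological bitop_sort;
  bitop_snd : Topological bitop_sort
}.

Definition fst_top (X : bitopologicalType) : topologicalType :=
  Topological.Pack (bitop_fst X).
Definition snd_top (X : bitopologicalType) : topologicalType :=
  Topological.Pack (bitop_snd X).

Definition homeomorphism (T U : topologicalType) (f : T -> U) : Prop :=
  continuous f /\
  exists g : U -> T, [/\ cancel f g, cancel g f & continuous g].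

Definition bitop_homeomorphism (X Y : bitopologicalType) (f : X -> Y) : Prop :=
  @homeomorphism (fst_top X) (fst_top Y) f /\
  @homeomorphism (snd_top X) (snd_top Y) f.

(* Zero-dimensionality is the existence of a base of clopen sets; the library's
   [zero_dimensional] only asks clopen sets to separate points. *)
Definition stone_space (T : topologicalType) : Prop :=
  [/\ compact [set: T], hausdorff_space T & basis (@clopen T)].

Definition clopens (T : topologicalType) : set (set T) := [set U | clopen U].
Arguments clopens : clear implicits.

Record Clop (T : topologicalType) := MkClop {
  clop_set :> set T;
  clop_mem : clop_set \in clopens T
}.

HB.instance Definition _ (T : topologicalType) := [isSub for @clop_set T].
HB.instance Definition _ (T : topologicalType) := [Choice of Clop T by <:].

Fact clop_display : Order.disp_t. Proof. exact: Order.Disp tt tt. Qed.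

Fact clopens_meet (T : topologicalType) : meet_closed (mem (clopens T)).
Proof. by move=> A B /set_mem cA /set_mem cB; apply/mem_set/clopenI. Qed.

Fact clopens_join (T : topologicalType) : join_closed (mem (clopens T)).
Proof. by move=> A B /set_mem cA /set_mem cB; apply/mem_set/clopenU. Qed.

Fact clopens_bot (T : topologicalType) : (\bot%O : set T) \in mem (clopens T).
Proof. exact/mem_set/clopen0. Qed.

Fact clopens_top (T : topologicalType) : (\top%O : set T) \in mem (clopens T).
Proof. exact/mem_set/clopenT. Qed.

HB.instance Definition _ (T : topologicalType) :=
  Order.SubChoice_isTBSubLattice.Build _ _ _ clop_display (Clop T)
    (@clopens_meet T) (@clopens_join T) (@clopens_bot T) (@clopens_top T).

Fact clop_val_inj (T : topologicalType) : injective (@clop_set T).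
Proof. exact: val_inj. Qed.

Lemma clop_meetE (T : topologicalType) (U V : Clop T) :
  clop_set (U `&` V)%O = clop_set U `&` clop_set V.
Proof. by []. Qed.

Lemma clop_joinE (T : topologicalType) (U V : Clop T) :
  clop_set (U `|` V)%O = clop_set U `|` clop_set V.
Proof. by []. Qed.

Lemma clop_botE (T : topologicalType) : clop_set (\bot%O : Clop T) = set0.
Proof. by []. Qed.

Lemma clop_topE (T : topologicalType) : clop_set (\top%O : Clop T) = setT.
Proof. by []. Qed.

Lemma clop_leE (T : topologicalType) (U V : Clop T) :
  (U <= V)%O <-> clop_set U `<=` clop_set V.
Proof. by rewrite -subsetEset. Qed.

Fact clop_meetUl (T : topologicalType) :
  @left_distributive (Clop T) (Clop T) Order.meet Order.join.
Proof.
by move=> U V W; apply: val_inj; exact: setIUl.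
Qed.

HB.instance Definition _ (T : topologicalType) :=
  Order.Lattice_Meet_isDistrLattice.Build clop_display (Clop T) (@clop_meetUl T).

Definition clop_compl (T : topologicalType) (U : Clop T) : Clop T :=
  MkClop (mem_set (clopenC set0 (set_mem (clop_mem U)))).

Fact clop_joinC (T : topologicalType) (U : Clop T) :
  (U `|` clop_compl U)%O = \top%O.
Proof. by apply: val_inj; exact: setUCr. Qed.

Fact clop_meetC (T : topologicalType) (U : Clop T) :
  (U `&` clop_compl U)%O = \bot%O.
Proof. by apply: val_inj; exact: setICr. Qed.

HB.instance Definition _ (T : topologicalType) :=
  Order.TBDistrLattice_hasComplement.Build clop_display (Clop T)
    (@clop_joinC T) (@clop_meetC T).

Lemma clop_complE (T : topologicalType) (U : Clop T) :
  clop_set (~` U)%O = ~` clop_set U.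
Proof. by []. Qed.

(* Boolean algebras are the complemented distributive lattices of the library. *)
Record is_S4_subordination (d : Order.disp_t) (A : ctbDistrLatticeType d)
    (prec : A -> A -> Prop) : Prop := IsS4Subordination {
  prec0 : prec \bot%O \bot%O;
  prec1 : prec \top%O \top%O;
  precI : forall a b c, prec a b -> prec a c -> prec a (b `&` c)%O;
  precU : forall a b c, prec a c -> prec b c -> prec (a `|` b)%O c;
  prec_le : forall a b c e, (a <= b)%O -> prec b c -> (c <= e)%O -> prec a e;
  prec_sub : forall a b, prec a b -> (a <= b)%O;
  prec_dense : forall a b, prec a b -> exists c, prec a c /\ prec c b
}.

Record S4_subordination_algebra (d : Order.disp_t) := S4SubordAlg {
  s4_sort :> ctbDistrLatticeType d;
  s4_prec : s4_sort -> s4_sort -> Prop;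
  s4_axioms : is_S4_subordination s4_prec
}.

Record proper_filter (d : Order.disp_t) (A : ctbDistrLatticeType d)
    (F : set A) : Prop := ProperFilterBA {
  pf_top : F \top%O;
  pf_bot : ~ F \bot%O;
  pf_meet : forall a b, F a -> F b -> F (a `&` b)%O;
  pf_up : forall a b, (a <= b)%O -> F a -> F b
}.

Definition is_ultrafilter (d : Order.disp_t) (A : ctbDistrLatticeType d)
    (F : set A) : Prop :=
  proper_filter F /\ forall G : set A, proper_filter G -> F `<=` G -> G = F.

Record Ul (d : Order.disp_t) (A : ctbDistrLatticeType d) := MkUl {
  ul_set :> set A;
  ul_ultra : is_ultrafilter ul_set
}.

Definition phi (d : Order.disp_t) (A : ctbDistrLatticeType d) (a : A) :
  set (Ul A) := [set x : Ul A | ul_set x a].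

Definition downset (d : Order.disp_t) (A : S4_subordination_algebra d) (a : A) :
  set A := [set b | s4_prec b a].

Definition beta (d : Order.disp_t) (A : ctbDistrLatticeType d) (D : set A) :
  set (Ul A) := [set x : Ul A | ul_set x `&` D !=set0].

Definition phi_base (d : Order.disp_t) (A : ctbDistrLatticeType d) :
  set (set (Ul A)) := range (@phi d A).

Definition beta_base (d : Order.disp_t) (A : S4_subordination_algebra d) :
  set (set (Ul A)) := range (fun a : A => beta (downset a)).

(* Two copies of the set of ultrafilters, one for each topology. *)
Definition phi_space (d : Order.disp_t) (A : ctbDistrLatticeType d) : Type :=
  Ul A.
Definition beta_space (d : Order.disp_t) (A : S4_subordination_algebra d) : Type :=
  Ul A.

HB.instance Definition _ (d : Order.disp_t) (A : ctbDistrLatticeType d) :=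
  gen_eqMixin (phi_space A).
HB.instance Definition _ (d : Order.disp_t) (A : ctbDistrLatticeType d) :=
  gen_choiceMixin (phi_space A).
HB.instance Definition _ (d : Order.disp_t) (A : S4_subordination_algebra d) :=
  gen_eqMixin (beta_space A).
HB.instance Definition _ (d : Order.disp_t) (A : S4_subordination_algebra d) :=
  gen_choiceMixin (beta_space A).

Fact phi_cover (d : Order.disp_t) (A : ctbDistrLatticeType d) :
  \bigcup_(B in @phi_base d A) B = [set: phi_space A].
Proof.
apply/seteqP; split=> // x _; exists (phi \top%O); first by exists \top%O.
by case: x => F [[]].
Qed.

Fact phi_join (d : Order.disp_t) (A : ctbDistrLatticeType d)
    (B C : set (Ul A)) (x : phi_space A) :
  @phi_base d A B -> @phi_base d A C -> B x -> C x ->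
  exists D, [/\ @phi_base d A D, D x & D `<=` B `&` C].
Proof.
move=> [a _ <-] [b _ <-] xa xb; exists (phi (a `&` b)%O); split.
- by exists (a `&` b)%O.
- by case: x xa xb => F [[? ? FI ?] ?]; exact: FI.
- by case=> F [[? ? ? Fup] ?] Fab; split; apply: Fup Fab; rewrite ?leIl ?leIr.
Qed.

HB.instance Definition _ (d : Order.disp_t) (A : ctbDistrLatticeType d) :=
  isBaseTopological.Build (phi_space A) (@phi_cover d A) (@phi_join d A).

Fact beta_cover (d : Order.disp_t) (A : S4_subordination_algebra d) :
  \bigcup_(B in @beta_base d A) B = [set: beta_space A].
Proof.
apply/seteqP; split=> // x _; exists (beta (downset (\top%O : A))).
  by exists \top%O.
exists \top%O; split; last exact: (prec1 (s4_axioms A)).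
by case: x => F [[]].
Qed.

Fact beta_join (d : Order.disp_t) (A : S4_subordination_algebra d)
    (B C : set (Ul A)) (x : beta_space A) :
  @beta_base d A B -> @beta_base d A C -> B x -> C x ->
  exists D, [/\ @beta_base d A D, D x & D `<=` B `&` C].
Proof.
have AS := s4_axioms A.
move=> [a _ <-] [b _ <-] [a' [xa' a'a]] [b' [xb' b'b]].
exists (beta (downset ((a `&` b)%O : A))); split.
- by exists (a `&` b)%O.
- exists (a' `&` b')%O; split.
    by case: x xa' xb' => F [[? ? FI ?] ?]; exact: FI.
  apply: (precI AS).
  + exact: (prec_le AS (leIl _ _) a'a (lexx _)).
  + exact: (prec_le AS (leIr _ _) b'b (lexx _)).
- move=> y [c [yc cab]]; split; exists c; split=> //.
  + exact: (prec_le AS (lexx _) cab (leIl _ _)).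
  + exact: (prec_le AS (lexx _) cab (leIr _ _)).
Qed.

HB.instance Definition _ (d : Order.disp_t) (A : S4_subordination_algebra d) :=
  isBaseTopological.Build (beta_space A) (@beta_cover d A) (@beta_join d A).

Definition dual_space (d : Order.disp_t) (A : S4_subordination_algebra d) :
    bitopologicalType :=
  @BiTop (Ul A) (Topological.class (phi_space A))
    (Topological.class (beta_space A)).

Lemma phi_basis (d : Order.disp_t) (A : S4_subordination_algebra d) :
  @basis (fst_top (dual_space A)) (@phi_base d A).
Proof.
split=> [B phiB|x B].
  by exists [set B]; [move=> _ ->|rewrite bigcup_set1].
case=> _ [[D' sD' <-] [C D'C Cx] sUB].
by exists C; [split=> //; exact: sD'|exact: subset_trans (bigcup_sup D'C) sUB].
Qed.

Lemma beta_basis (d : Order.disp_t) (A : S4_subordination_algebra d) :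
  @basis (snd_top (dual_space A)) (@beta_base d A).
Proof.
split=> [B betaB|x B].
  by exists [set B]; [move=> _ ->|rewrite bigcup_set1].
case=> _ [[D' sD' <-] [C D'C Cx] sUB].
by exists C; [split=> //; exact: sD'|exact: subset_trans (bigcup_sup D'C) sUB].
Qed.

Definition int_S (X : bitopologicalType) (U : set X) : set X :=
  @interior (snd_top X) U.

Definition prec_S (X : bitopologicalType) (U V : Clop (fst_top X)) : Prop :=
  clop_set U `<=` int_S (clop_set V).

Definition le_S (X : bitopologicalType) (x y : X) : Prop :=
  forall U : Clop (fst_top X), int_S (clop_set U) x -> int_S (clop_set U) y.

Definition tri_S (X : bitopologicalType) (x y : X) : Prop :=
  forall U : Clop (fst_top X), int_S (clop_set U) x -> clop_set U y.

Record S4_subordination_space (X : bitopologicalType) : Prop :=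
    S4SubordinationSpace {
  Sp1 : stone_space (fst_top X);
  Sp2 : @basis (snd_top X)
          (range (fun U : Clop (fst_top X) => int_S (clop_set U)));
  Sp3 : forall U : Clop (fst_top X), @open (fst_top X) (int_S (clop_set U));
  Sp4 : forall x y : X, tri_S x y -> le_S x y
}.

Fact clop_closed (T : topologicalType) (U : Clop T) : closed (clop_set U).
Proof. by case: (set_mem (clop_mem U)). Qed.

Fact int_S_sub (X : bitopologicalType) (U : set X) : int_S U `<=` U.
Proof. exact: (@interior_subset (snd_top X)). Qed.

Fact int_S_le (X : bitopologicalType) (U V : set X) :
  U `<=` V -> int_S U `<=` int_S V.
Proof. exact: (@interiorS (snd_top X)). Qed.

Fact int_SI (X : bitopologicalType) (U V : set X) :
  int_S (U `&` V) = int_S U `&` int_S V.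
Proof. exact: (@interiorI (snd_top X)). Qed.

Fact int_ST (X : bitopologicalType) : int_S [set: X] = [set: X].
Proof. exact: (@interiorT (snd_top X)). Qed.

Fact int_S_interp (X : bitopologicalType) (hX : S4_subordination_space X)
    (V : Clop (fst_top X)) (x : X) : int_S (clop_set V) x ->
  exists W : Clop (fst_top X),
    int_S (clop_set W) x /\ clop_set W `<=` int_S (clop_set V).
Proof.
move=> Vx; apply: contrapT => nW.
have [cX _ _] := Sp1 hX.
pose D := [set W : Clop (fst_top X) | int_S (clop_set W) x].
pose K : set (fst_top X) := ~` int_S (clop_set V).
pose F : set_system (fst_top X) :=
  filter_from D (fun W => clop_set W `&` K).
have FF : ProperFilter F.
  apply: filter_from_proper; last first.
    move=> W Wx; apply: contrapT => WK; apply: nW; exists W; split=> // y Wy.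
    by apply: contrapT => nVy; apply: WK; exists y.
  apply: filter_from_filter.
    by exists \top%O; rewrite /D /= int_ST.
  move=> W W' Wx W'x; exists (W `&` W')%O.
    by rewrite /D /= int_SI.
  by move=> y [[Wy W'y] Ky].
have [p [_ clp]] := cX F FF (filterT).
have clpF (A : set (fst_top X)) : closed A -> F A -> A p.
  by move=> cA FA; apply: cA => B Bp; exact: clp.
have xp : tri_S x p.
  move=> U Ux; apply: (clpF _ (@clop_closed _ U)).
  by exists U => // y [].
have Kp : K p.
  apply: clpF; first exact/open_closedC/(Sp3 hX).
  by exists V => // y [].
by apply: Kp; exact: (Sp4 hX xp).
Qed.

Theorem prec_S_S4 (X : bitopologicalType) (hX : S4_subordination_space X) :
  is_S4_subordination (@prec_S X).
Proof.
split.
- by move=> ?.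
- by move=> x _; rewrite /= int_ST.
- by move=> U V W UV UW x Ux; rewrite /= int_SI; split; [exact: UV|exact: UW].
- by move=> U V W UW VW x [/UW|/VW].
- move=> U V W Z /clop_leE UV VW /clop_leE WZ x /UV /VW; exact: int_S_le.
- move=> U V UV; apply/clop_leE => x /UV; exact: int_S_sub.
- move=> U V UV; apply: contrapT => nW.
  have [cX _ _] := Sp1 hX.
  pose D := [set W : Clop (fst_top X) | clop_set W `<=` int_S (clop_set V)].
  pose F : set_system (fst_top X) :=
    filter_from D (fun W => clop_set U `\` int_S (clop_set W)).
  have FF : ProperFilter F.
    apply: filter_from_proper; last first.
      move=> W WV; apply: contrapT => UW; apply: nW; exists W; split=> // x Ux.
      by apply: contrapT => nWx; apply: UW; exists x.
    apply: filter_from_filter; first by exists \bot%O => x [].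
    move=> W W' WV W'V; exists (W `|` W')%O; first by move=> x [/WV|/W'V].
    move=> x [Ux nWx]; split; split=> // Wx; apply: nWx.
      by apply: int_S_le Wx => y; left.
    by apply: int_S_le Wx => y; right.
  have [p [_ clp]] := cX F FF (filterT).
  have Up : clop_set U p.
    apply: (@clop_closed _ U) => B Bp; apply: clp => //.
    by exists \bot%O; [move=> x []|move=> x []].
  have [W [Wp WV]] := int_S_interp hX (UV _ Up).
  have nbW : nbhs (p : fst_top X) (int_S (clop_set W)).
    by apply: open_nbhs_nbhs; split => //; exact: (Sp3 hX).
  have FW : F (clop_set U `\` int_S (clop_set W)) by exists W.
  by have [y [[]]] := clp _ _ FW nbW.
Qed.

Definition Clop_algebra (X : bitopologicalType) (hX : S4_subordination_space X) :
    S4_subordination_algebra clop_display :=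
  @S4SubordAlg clop_display (Clop (fst_top X)) (@prec_S X) (prec_S_S4 hX).

Definition eps_set (T : topologicalType) (x : T) : set (Clop T) :=
  [set U | clop_set U x].

Fact eps_ultra (T : topologicalType) (x : T) : is_ultrafilter (eps_set x).
Proof.
split; first by split=> //; move=> U V /clop_leE UV; exact: UV.
move=> G [_ Gbot Gmeet _] sG; apply/seteqP; split=> // U GU.
apply: contrapT => nUx; apply: Gbot; rewrite -(clop_meetC U); apply: Gmeet => //.
exact: sG.
Qed.

Definition eps (T : topologicalType) (x : T) : Ul (Clop T) :=
  MkUl (@eps_ultra T x).

(* Main.v *)
Require Import Defs.
From mathcomp Require Import all_boot all_order.
From mathcomp Require Import boolp classical_sets filter topology.

(** Stone duality provides the bijection.  An ultrafilter [u] of clopen sets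
    generates a proper filter on a compact space, and a cluster point [p] of
    that filter lies in every member of [u] because the members are closed;
    hence [u] is contained in [eps p], and maximality of [u] makes them equal.
    Conversely a point of a Hausdorff space with a base of clopen sets is
    determined by the clopen sets that contain it.

    Being a homeomorphism is then a matter of matching bases: a bijection under
    which the preimages of the members of one base are exactly the members of
    another is a homeomorphism.  The preimage of [phi U] under [eps] is [U]
    itself.  The preimage of [beta (downset U)] is [int_S U]: the points [x] that
    lie in some clopen [W] with [W `<=` int_S U].  That every point of [int_S U]
    has such a [W] is the interpolation property [int_S_interp], where (Sp3),
    (Sp4) and compactness enter; (Sp2) says that the sets [int_S U] form a base
    of the second topology. *)

Set Implicit Arguments.
Unset Strict Implicit.
Unset Printing Implicit Defensive.

Local Open Scope classical_set_scope.

Lemma basis_continuous (T U : topologicalType) (B : set_system U)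
    (f : T -> U) : basis B -> (forall V, B V -> open (f @^-1` V)) -> continuous f.
Proof.
move=> [_ Bnbhs] fB x A /Bnbhs [V [BV Vfx] sVA].
apply: (@filterS _ (nbhs x) _ (f @^-1` V)); first by move=> y /sVA.
by apply: open_nbhs_nbhs; split=> //; exact: fB.
Qed.

(** The two bases are indexed by the same type, so that the hypothesis on
    preimages under [f] also controls preimages under [g]: since [f \o g] is the
    identity, [g @^-1` b i = c i]. *)
Lemma basis_homeomorphism (T U : topologicalType) (I : Type)
    (b : I -> set T) (c : I -> set U) (f : T -> U) (g : U -> T) :
  basis (range b) -> basis (range c) -> (forall i, f @^-1` c i = b i) ->
  cancel f g -> cancel g f -> homeomorphism f.
Proof.
move=> Bb Bc fcb fK gK; split.
  apply: (basis_continuous Bc) => _ [i _ <-].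
  by rewrite fcb; apply: (proj1 Bb); exists i.
exists g; split=> //; apply: (basis_continuous Bb) => _ [i _ <-].
have -> : g @^-1` b i = c i.
  by rewrite -fcb; apply/seteqP; split=> y; rewrite /preimage /= gK.
by apply: (proj1 Bc); exists i.
Qed.

Lemma range_clop_set (T : topologicalType) : range (@clop_set T) = clopen.
Proof.
apply/seteqP; split=> [_ [U _ <-]|U cU]; first exact: set_mem (clop_mem U).
by exists (MkClop (mem_set cU)).
Qed.

Lemma Ul_inj (d : Order.disp_t) (A : ctbDistrLatticeType d) :
  injective (@ul_set d A).
Proof.
move=> [F uF] [G uG] /= FG; rewrite FG in uF *.
by rewrite (Prop_irrelevance uF uG).
Qed.

(** If [x] and [y] lie in the same clopen sets, then every neighbourhood of [x]
    contains [y], as it contains a clopen neighbourhood of [x]; so [y] is a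
    cluster point of [nbhs x]. *)
Lemma eps_inj (T : topologicalType) :
  hausdorff_space T -> basis (@clopen T) -> injective (@eps T).
Proof.
move=> hT [_ Tnbhs] x y /(congr1 (@ul_set _ _)) /= exy.
apply: hT => A B /Tnbhs [U [cU Ux] sUA] By; exists y; split.
  apply: sUA; have : eps_set x (MkClop (mem_set cU)) by [].
  by rewrite exy.
exact: nbhs_singleton By.
Qed.

(** The members of [u] are nonempty, so they generate a proper filter [F]; the
    preimage of [u] is a cluster point of [F]. *)
Lemma eps_surj (T : topologicalType) (u : Ul (Clop T)) :
  compact [set: T] -> exists x, eps x = u.
Proof.
move=> cT; have [[utop ubot umeet uup] umax] := ul_ultra u.
pose F : set_system T := filter_from (ul_set u) (@clop_set T).
have FF : ProperFilter F.
  apply: filter_from_proper.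
    apply: filter_from_filter; first by exists \top%O.
    by move=> U V uU uV; exists (U `&` V)%O => //; exact: umeet.
  move=> U uU; apply: contrapT => U0; apply: ubot.
  (* an empty member of [u] would lie below [\bot] *)
  apply: uup uU; apply/clop_leE => x Ux.
  by case: U0; exists x.
have [p [_ clp]] := cT F FF filterT.
exists p; apply: Ul_inj; apply: umax; first by have [] := eps_ultra p.
by move=> U uU; apply: (@clop_closed _ U) => B; apply: clp; exists U.
Qed.

(** The inclusion of [int_S U] in the preimage is the interpolation property of
    [S4]-subordination spaces. *)
Lemma eps_preimage_beta (X : bitopologicalType)
    (hX : S4_subordination_space X) (U : Clop_algebra hX) :
  @eps (fst_top X) @^-1` beta (downset U) = int_S (clop_set U).
Proof.
apply/seteqP; split=> x; first by case=> W [Wx]; exact.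
move=> /(int_S_interp hX) [W [Wx WU]]; exists W; split=> //.
exact: int_S_sub Wx.
Qed.

Theorem theorem12 (X : bitopologicalType) (hX : S4_subordination_space X) :
  @bitop_homeomorphism X (dual_space (Clop_algebra hX)) (@eps (fst_top X)).
Proof.
have [cX hausX bX] := Sp1 hX.
have [g gK] := choice (fun u => eps_surj u cX).
have fK : cancel (@eps (fst_top X)) g by move=> x; exact: (eps_inj hausX bX).
split.
  apply: (@basis_homeomorphism (fst_top X) (fst_top (dual_space (Clop_algebra hX)))
    _ (@clop_set _) (@phi _ _) _ g) => //; last exact: phi_basis.
  by rewrite range_clop_set.
apply: (@basis_homeomorphism (snd_top X) (snd_top (dual_space (Clop_algebra hX)))
  _ (fun U : Clop (fst_top X) => int_S (clop_set U))
  (fun U : Clop_algebra hX => beta (downset U)) _ g) => //.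
- exact: Sp2.
- exact: beta_basis.
- exact: eps_preimage_beta.
Qed.
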